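(* For any integer $r\geq 2$ and any $n\in\mathbb{N}$, every $(K_{1,r},K_{1,r}[n])$-partite-saturated graph has exactly $(r-1)n^2$ edges.
   Context: For a graph $H$ and $n\in\mathbb{N}$ (with $n\ge 1$), $H[n]$ is the graph obtained from $H$ by replacing each vertex with an independent set (a part) of size $n$ and each edge with a complete bipartite graph between the corresponding parts. A copy of $H$ in $H[n]$ is partite if it has exactly one vertex in each part of $H[n]$. A spanning subgraph $G\subseteq H[n]$ is $H$-partite-free if it contains no partite copy of $H$. $G$ is $(H,H[n])$-partite-saturated if $G$ is $H$-partite-free but for every edge $uv\in E(H[n])\setminus E(G)$ the graph $G\cup uv$ contains a partite copy of $H$. $K_{1,r}$ is the star with $r$ leaves. *)

(* Defs.v *)
From mathcomp Require Import all_boot.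

Set Implicit Arguments.
Unset Strict Implicit.
Unset Printing Implicit Defensive.

(* A simple graph on V is an adjacency relation e : rel V with is_sgraph e. *)
Definition is_sgraph (V : finType) (e : rel V) : Prop :=
  symmetric e /\ irreflexive e.

Definition edge_set (V : finType) (e : rel V) : {set {set V}} :=
  [set [set p.1; p.2] | p : V * V & e p.1 p.2].

Definition add_edge (V : finType) (e : rel V) (u v : V) : rel V :=
  fun x y => [|| e x y, (x == u) && (y == v) | (x == v) && (y == u)].

(* The vertex (a, i) of H[n] is the i-th vertex of the part of a. *)
Definition blowup (A : finType) (H : rel A) (n : nat) : rel (A * 'I_n) :=
  fun x y => H x.1 y.1.

(* f embeds H in G as a not necessarily induced subgraph. *)
Definition is_copy (A V : finType) (H : rel A) (G : rel V) (f : A -> V) : Prop :=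
  injective f /\ forall a b : A, H a b -> G (f a) (f b).

(* The vertex f a of the copy need not lie in the part of a itself. *)
Definition partite (A : finType) (n : nat) (f : A -> A * 'I_n) : Prop :=
  forall b : A, exists! a : A, (f a).1 = b.

Definition has_partite_copy (A : finType) (H : rel A) (n : nat)
    (G : rel (A * 'I_n)) : Prop :=
  exists f : A -> A * 'I_n, is_copy H G f /\ partite f.

Definition spanning_subgraph (V : finType) (G K : rel V) : Prop :=
  is_sgraph G /\ subrel G K.

Definition partite_saturated (A : finType) (H : rel A) (n : nat)
    (G : rel (A * 'I_n)) : Prop :=
  [/\ spanning_subgraph G (blowup H (n := n)),
      ~ has_partite_copy H G
    & forall u v : A * 'I_n, blowup H u v -> ~~ G u v ->
        has_partite_copy H (add_edge G u v)].

(* K_{1,r}, with centre ord0. *)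
Definition star (r : nat) : rel 'I_r.+1 :=
  fun i j => (i == ord0) != (j == ord0).

Lemma star_sgraph (r : nat) : is_sgraph (@star r).
Proof. by split=> [i j|i]; rewrite /star 1?eq_sym ?eqxx. Qed.

Lemma blowup_sgraph (A : finType) (H : rel A) (n : nat) :
  is_sgraph H -> is_sgraph (blowup H (n := n)).
Proof. by case=> symH irrH; split=> [x y|x]; [exact: symH | exact: irrH]. Qed.

(* Main.v *)
Require Import Defs.
From mathcomp Require Import all_boot.

(** Write V_0 for the part of the centre of the star and V_1, ..., V_r for the
    other parts.  Every edge joins V_0 to some V_i, so as r >= 2 a partite
    copy has its centre in V_0: otherwise all its leaves, at least two, would
    lie in V_0.  Hence G has a partite copy exactly when some vertex of V_0
    has a neighbour in every other part (lemmas [star_copy_centre] and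
    [centre_star_copy]).

    Let G be saturated and v in V_0.  As G is free, v has no neighbour in some
    V_i.  Let w lie in V_j with j different from 0 and i.  Adding an edge vw
    changes, among the vertices of V_0, only the neighbourhood of v, and v
    still has no neighbour in V_i; so no copy can arise, and vw must already
    be an edge.  Thus v is joined to exactly the r - 1 parts other than V_0
    and V_i ([saturated_adjacency]), and has degree (r - 1) n.  Summing over
    the n vertices of V_0, which meets each edge exactly once
    ([card_edge_set_star]), gives (r - 1) n^2. *)

Set Implicit Arguments.
Unset Strict Implicit.
Unset Printing Implicit Defensive.

Section StarBlowup.

Variables r n : nat.
Implicit Types (G : rel ('I_r.+1 * 'I_n)) (v : 'I_n).

Definition meets_leaf_parts G v : Prop :=
  forall i : 'I_r.+1, i != ord0 -> exists w : 'I_n, G (ord0, v) (i, w).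

(** A centre outside V_0 would force its leaves 1 and 2 into the same part
    V_0. *)
Lemma star_copy_centre G :
  2 <= r -> subrel G (blowup (@star r) (n := n)) ->
  has_partite_copy (@star r) G -> exists v, meets_leaf_parts G v.
Proof.
move=> r_ge2 GK [f [[_ fG] fpart]].
have centre0 : (f ord0).1 = ord0.
  case: (eqVneq (f ord0).1 ord0) => // f0.
  have leaf0 (a : 'I_r.+1) : a != ord0 -> (f a).1 = ord0.
    move=> a0; have /fG/GK : star ord0 a by rewrite /star eqxx (negPf a0).
    by rewrite /blowup /star (negPf f0); case: ((f a).1 =P ord0).
  have [a [_ a_uniq]] := fpart ord0.
  have leaf_eq (k : nat) : 0 < k <= 2 -> a = inord k :> 'I_r.+1.
    case/andP=> k_gt0 k_le2; apply: a_uniq; apply: leaf0.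
    by rewrite -val_eqE /= inordK -?lt0n // ltnS (leq_trans k_le2).
  have /(congr1 val) : inord 1 = inord 2 :> 'I_r.+1 by rewrite -!leaf_eq.
  by rewrite /= !inordK // ltnS ltnW.
exists (f ord0).2 => i i0.
have [a [fa _]] := fpart i.
have a0 : a != ord0 by apply: contraNneq i0 => a0; rewrite -fa a0 centre0.
exists (f a).2; rewrite -{1}centre0 -fa -!surjective_pairing.
by apply: fG; rewrite /star eqxx (negPf a0).
Qed.

Lemma centre_star_copy G v :
  symmetric G -> meets_leaf_parts G v -> has_partite_copy (@star r) G.
Proof.
move=> symG Gv.
have Gv_bool (i : 'I_r.+1) :
    exists w : 'I_n, (i != ord0) ==> G (ord0, v) (i, w).
  by case: eqVneq => [_|/Gv[w Gw]]; [exists v | exists w].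
pose leaf i := xchoose (Gv_bool i).
have leafP i : i != ord0 -> G (ord0, v) (i, leaf i).
  exact: (implyP (xchooseP (Gv_bool i))).
exists (fun i => (i, if i == ord0 then v else leaf i)); split; last first.
  by move=> b; exists b; split=> // a /= ->.
split=> [a b [] //|a b].
rewrite /star; case: (eqVneq a ord0) => [->|a0]; case: (eqVneq b ord0) => [->|b0] //= _.
  exact: leafP.
by rewrite symG; apply: leafP.
Qed.

(** If v misses V_i, an edge from v to another part leaves V_i missed, hence
    completes no copy: saturation forces that edge to be present already. *)
Lemma saturated_adjacency G v :
  2 <= r -> partite_saturated (@star r) G ->
  exists2 i : 'I_r.+1, i != ord0 &
    forall w, G (ord0, v) w = (w.1 \notin [set ord0; i]).
Proof.
move=> r_ge2 [[[symG _] GK] Gfree Gsat].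
have [i i0 missing] : exists2 i : 'I_r.+1, i != ord0 &
    forall w : 'I_n, ~~ G (ord0, v) (i, w).
  case: (pickP [pred i : 'I_r.+1 |
    (i != ord0) && [forall w : 'I_n, ~~ G (ord0, v) (i, w)]]) => [i|all_met].
    by case/andP=> i0 /forallP; exists i.
  case: Gfree; apply: (centre_star_copy (v := v)) => // i i0.
  have := all_met i; rewrite /= i0 /= => /negbT; rewrite negb_forall.
  by case/existsP=> w /negbNE; exists w.
exists i => // -[j w]; rewrite in_set2 negb_or /=.
case: (eqVneq j ord0) => [->|j0] /=.
  by apply/negP => /GK.
case: (eqVneq j i) => [->|ji] /=; first exact/negbTE.
apply: contraT => nGvw; have Kvw : blowup (@star r) (ord0, v) (j, w).
  by rewrite /blowup /star /= (negPf j0).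
case: Gfree; have addK : subrel (add_edge G (ord0, v) (j, w))
    (blowup (@star r) (n := n)).
  move=> x y; case/or3P=> [/GK //|/andP[/eqP-> /eqP->] //|].
  case/andP=> /eqP-> /eqP->.
  by rewrite (blowup_sgraph n (star_sgraph r)).1.
have [c cP] := star_copy_centre r_ge2 addK (Gsat _ _ Kvw nGvw).
(* The centre c cannot be v, which the new edge leaves without a neighbour in
   V_i; so all neighbours of c in the enlarged graph are neighbours in G. *)
have cv : c != v.
  apply/eqP => cv; have [x] := cP i i0.
  rewrite cv /add_edge (negPf (missing x)) !xpair_eqE eqxx /=.
  by rewrite [i == j]eq_sym [ord0 == j]eq_sym (negPf ji) (negPf j0) andbF.
apply: (centre_star_copy (v := c)) => // k k0; have [x] := cP k k0.
rewrite /add_edge !xpair_eqE (negPf cv) [ord0 == j]eq_sym (negPf j0) /=.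
by rewrite orbF; exists x.
Qed.

(** Each edge is counted at its only endpoint in V_0. *)
Lemma card_edge_set_star G :
  spanning_subgraph G (blowup (@star r) (n := n)) ->
  #|edge_set G| = \sum_(v < n) #|[set w | G (ord0, v) w]|.
Proof.
case=> [[symG _] GK].
pose S := [set p : 'I_n * ('I_r.+1 * 'I_n) | G (ord0, p.1) p.2].
pose edge_of (p : 'I_n * ('I_r.+1 * 'I_n)) := [set (ord0, p.1); p.2].
have end0 (v : 'I_n) w : G (ord0, v) w -> w.1 != ord0.
  by move/GK; rewrite /blowup /star eqxx; case: (w.1 =P ord0).
have -> : edge_set G = edge_of @: S.
  apply/setP => E; apply/imsetP/imsetP => [[[[a x] [b y]]]|[[v w]]].
    rewrite inE /= => Gxy ->; have := GK _ _ Gxy; rewrite /blowup /star /=.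
    case: (eqVneq a ord0) => [a0 _|_].
      by exists (x, (b, y)); rewrite ?inE -?a0 // /edge_of a0.
    case: (eqVneq b ord0) => // b0 _.
    exists (y, (a, x)); first by rewrite inE /= -b0 symG.
    by rewrite /edge_of b0 setUC.
  by rewrite inE => Gvw ->; exists ((ord0, v), w); rewrite ?inE.
rewrite card_in_imset => [|[v w] [v' w']]; last first.
  rewrite !inE /= => /end0 w0 /end0 w'0 /setP E.
  have := E (ord0, v); rewrite !inE eqxx /= => /esym/orP[] /eqP; last first.
    by move=> vw'; rewrite -vw' eqxx in w'0.
  case=> ->; have := E w; rewrite !inE eqxx orbT => /esym/orP[] /eqP.
    by move=> wv; rewrite wv eqxx in w0.
  by move=> ->.
rewrite -sum1_card (eq_bigl (fun p => true && G (ord0, p.1) p.2)); last first.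
  by move=> p; rewrite inE.
rewrite -(pair_big_dep xpredT (fun v w => G (ord0, v) w) (fun _ _ => 1)) /=.
by apply: eq_bigr => v _; rewrite -sum1_card; apply: eq_bigl => w; rewrite inE.
Qed.

End StarBlowup.

Theorem theorem10 (r n : nat) (hr : 2 <= r) (hn : 1 <= n)
    (G : rel ('I_r.+1 * 'I_n)) :
  partite_saturated (@star r) G -> #|edge_set G| = (r - 1) * n ^ 2.
Proof.
move=> satG; case: (satG) => spanG _ _; rewrite card_edge_set_star //.
rewrite (eq_bigr (fun=> (r - 1) * n)) => [|v _].
  by rewrite sum_nat_const card_ord mulnCA mulnn.
have [i i0 adj] := saturated_adjacency v hr satG.
have -> : [set w | G (ord0, v) w] = setX (~: [set ord0; i]) [set: 'I_n].
  by apply/setP => w; rewrite !inE adj !inE andbT.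
by rewrite cardsX cardsT card_ord cardsCs setCK cards2 eq_sym i0 card_ord subSS.
Qed.
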